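(* Let $M>0$, $r\in(0,1/2)$ and $b\ge 0$. There is a constant $C(M,r,b)$, depending only on $M,r,b$, such that the following holds. Let $\Omega$ be a compact subset of $\mathbb R^d$, let $\mu$ be a Borel probability measure on $\Omega$, and let $W\subset \mathcal C(\Omega)$ be a compact (in the uniform norm) class of real continuous functions such that $\|f\|_\infty\le M$ for all $f\in W$. Assume that the entropy numbers of $W$ in the uniform norm satisfy $$\varepsilon_n(W)\le n^{-r}(\log(n+1))^b,\qquad n\in\mathbb N.$$ Then $$er_m(W,L_2)\le C(M,r,b)\,m^{-r}(\log(m+1))^b,\qquad m\in\mathbb N.$$
   Context: $\mathcal C(\Omega)$ is the Banach space of continuous real functions on $\Omega$ with norm $\|f\|_\infty=\sup_{x\in\Omega}|f(x)|$. For a compact subset $\Theta$ of a Banach space $B$ with closed unit ball $U(B)$, the entropy numbers are $$\varepsilon_n(\Theta,B):=\inf\Big\{\varepsilon:\ \exists f_1,\dots,f_{2^n}\in\Theta:\ \Theta\subset\bigcup_{j=1}^{2^n}(f_j+\varepsilon U(B))\Big\},$$ and $\varepsilon_n(W):=\varepsilon_n(W,\mathcal C(\Omega))$. The optimal error of sampling discretization of the square norm is $$er_m(W,L_2):=\inf_{\xi^1,\dots,\xi^m\in\Omega}\ \sup_{f\in W}\Big|\int_\Omega |f|^2\,d\mu-\frac1m\sum_{j=1}^m|f(\xi^j)|^2\Big|.$$ $\log$ is the logarithm to a fixed base greater than $1$ (constants may depend on the base). *)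

(* Defs.v *)
From HB Require Import structures.
From mathcomp Require Export all_boot all_order all_algebra.
From mathcomp Require Export all_classical all_reals all_analysis.

Set Implicit Arguments.
Unset Strict Implicit.
Unset Printing Implicit Defensive.

Import Order.TTheory GRing.Theory Num.Theory.
Import numFieldNormedType.Exports.

Local Open Scope classical_set_scope.
Local Open Scope ring_scope.

(* A function on Omega is represented by any function on the whole of R^d with
   that restriction to Omega: every notion below depends only on the values
   taken on Omega. *)

(* A Borel probability measure on a closed subset Omega of R^d is identified
   with a probability measure mu on this type such that mu Omega = 1. *)
Definition borel_rV (R : realType) (d : nat) :=
  g_sigma_algebraType (@open 'rV[R]_d).

Section Definitions.
Context {R : realType} {d : nat}.
Implicit Types (Omega : set 'rV[R]_d) (W : set ('rV[R]_d -> R)).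

Definition continuous_functions Omega : set ('rV[R]_d -> R) :=
  [set f | {within Omega, continuous f}].

(* The topology of {uniform` Omega -> R} is the one of uniform convergence on
   Omega; it identifies functions that agree on Omega, so that W is compact in
   it iff the set of restrictions to Omega is compact in the uniform norm. *)
Definition uniformly_compact Omega W : Prop :=
  compact (W : set {uniform` Omega -> R}).

Definition sup_norm Omega (f : 'rV[R]_d -> R) : \bar R :=
  ereal_sup [set `|f x|%:E | x in Omega].

(* With values in \bar R, so that the infimum over an empty set is +oo. *)
Definition entropy_number Omega W (n : nat) : \bar R :=
  ereal_inf [set eps%:E | eps in [set eps : R |
    0 <= eps /\
    exists c : 'I_(2 ^ n) -> ('rV[R]_d -> R),
      (forall j, W (c j)) /\
      W `<=` \bigcup_j [set f | (sup_norm Omega (f - c j)%R <= eps%:E)%E]]].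

Definition discretization_error (mu : probability (borel_rV R d) R)
    Omega (m : nat) (xi : 'I_m -> 'rV[R]_d) (f : 'rV[R]_d -> R) : R :=
  `| (\int[mu]_(x in Omega) (`|f x| ^+ 2))
     - m%:R^-1 * \sum_(j < m) `|f (xi j)| ^+ 2 |.

Definition er_L2 (mu : probability (borel_rV R d) R) Omega W (m : nat) :
    \bar R :=
  ereal_inf [set ereal_sup [set (discretization_error mu Omega xi f)%:E
                           | f in W]
            | xi in [set xi : 'I_m -> 'rV[R]_d | forall j, Omega (xi j)]].

End Definitions.

Definition log_base {R : realType} (a x : R) : R := ln x / ln a.

(* Main.v *)
(* Chaining along nets of cardinality 2^(2^k), k <= log_2 m, applied to the
   squares f^2, with Hoeffding-type control of the increments at each level.
   As r < 1/2, the level-k contributions to the error, of order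
   eps_(2^k) (2^k / m)^(1/2), grow geometrically in k, so that the last level,
   where 2^k is about m, dominates and gives m^(-r) (log m)^b.

   The sampling points are not drawn at random on a product space but chosen
   one after the other (method of conditional expectations): if the g_i have
   mean zero and |g_i| <= B_i, then sum_i u_i exp(g_i(x) - 2 B_i^2) is at most
   its initial value sum_i u_i plus a mean-zero function of x, so some x keeps
   this potential below 1. *)
Require Import Defs.
From mathcomp Require Import measurable_realfun ring lra.

Set Implicit Arguments.
Unset Strict Implicit.
Unset Printing Implicit Defensive.

Import Order.TTheory GRing.Theory Num.Theory.
Import numFieldNormedType.Exports.

Local Open Scope classical_set_scope.
Local Open Scope ring_scope.

(** * An exponential inequality and the sequential choice of points *)

(** A pointwise form of Hoeffding's lemma: the linear term integrates to zero for a centred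
    function, which leaves only the quadratic exponent. *)
Lemma expR_le_addr_expR_sqr (R : realType) (x : R) :
  expR x <= x + expR (2 * x ^+ 2).
Proof.
have [x1|x1] := leP x 1; last first.
  apply: (@le_trans _ _ (expR (2 * x ^+ 2))); last lra.
  rewrite ler_expR; nra.
have hx : 1 - x / 2 <= expR (- (x / 2)) by have := expR_ge1Dx (- (x / 2)); lra.
have e2 : expR x * expR (- (x / 2)) ^+ 2 = 1.
  by rewrite -expRM_natl -expRD -[RHS]expR0; congr expR; lra.
have sq : (1 - x / 2) ^+ 2 <= expR (- (x / 2)) ^+ 2.
  by rewrite ler_sqr ?nnegrE ?expR_ge0//; lra.
(* Since [expR (- x) >= (1 - x / 2) ^+ 2], this gives [expR x <= 1 + x + 2 * x ^+ 2]. The excess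
   over 1 factors through [1 - x] and [5 / 2 - x], both nonnegative for [x <= 1]. *)
have q1 : 1 <= (1 + x + 2 * x ^+ 2) * (1 - x / 2) ^+ 2.
  have -> : (1 + x + 2 * x ^+ 2) * (1 - x / 2) ^+ 2 =
    1 + x ^+ 2 * ((1 - x) * (5 / 2 - x) / 2) by field.
  rewrite lerDl mulr_ge0 ?sqr_ge0// mulr_ge0 ?invr_ge0//.
  by apply: mulr_ge0; lra.
apply: (@le_trans _ _ (1 + x + 2 * x ^+ 2)); last first.
  by have := expR_ge1Dx (2 * x ^+ 2); lra.
have p0 : 0 <= 1 + x + 2 * x ^+ 2 by nra.
have s0 : 0 < expR (- (x / 2)) ^+ 2 by rewrite exprn_gt0// expR_gt0.
rewrite -(ler_pM2r s0) e2 (le_trans q1)//.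
exact: ler_wpM2l.
Qed.

(** Integrability is included because the real-valued integral is [fine] of the extended one, so an
    infinite integral would also read as 0. *)
Definition mean_zero {d} {T : measurableType d} {R : realType}
    (mu : probability T R) (D : set T) (g : T -> R) :=
  mu.-integrable D (EFin \o g) /\ \int[mu]_(x in D) g x = 0.

Section MeanZero.
Context d (T : measurableType d) (R : realType) (mu : probability T R).
Context (D : set T) (mD : measurable D) (muD : mu D = 1%E).

Lemma mean_zero_scale (a : R) (g : T -> R) :
  mean_zero mu D g -> mean_zero mu D (fun x => a * g x).
Proof.
move=> [ig g0]; split; last by rewrite RintegralZl// g0 mulr0.
by apply: eq_integrable (integrableZl mD a ig) => // x _ /=; rewrite EFinM.
Qed.

Lemma mean_zero_sum (I : finType) (g : I -> T -> R) :
  (forall i, mean_zero mu D (g i)) ->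
  mean_zero mu D (fun x => \sum_i g i x).
Proof.
move=> g0; rewrite -fct_sumE; elim/big_ind : _ => [|f1 f2 [i1 e1] [i2 e2]|//].
  split; last by rewrite Rintegral_cst// mul0r.
  exact: integrable0.
split; last by rewrite RintegralD// e1 e2 addr0.
by apply: eq_integrable (integrableD mD i1 i2).
Qed.

(** Otherwise [g >= e] on [D], and integrating over a set of measure one gives [0 >= e]. *)
Lemma mean_zero_lt (g : T -> R) (e : R) :
  mean_zero mu D g -> 0 < e -> exists2 x, D x & g x < e.
Proof.
move=> [ig g0] e0; apply: contrapT => H.
suff : e <= 0 by rewrite leNgt e0.
have -> : e = \int[mu]_(x in D) e.
  rewrite Rintegral_cst// (_ : fine _ = 1) ?mulr1//.
  exact: (congr1 fine muD).
rewrite -g0; apply: le_Rintegral => //.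
  apply: measurable_bounded_integrable => //; first by have := ltry (1 : R); rewrite -muD.
  by exists `|e|; split => // M eM y _ /=; exact: ltW.
by move=> x Dx; rewrite leNgt; apply/negP => gx; apply: H; exists x.
Qed.

Lemma exists_good_point (I : finType) (u B : I -> R) (g : I -> T -> R) :
  (forall i, 0 <= u i) -> \sum_i u i < 1 ->
  (forall i, mean_zero mu D (g i)) ->
  (forall i x, D x -> `|g i x| <= B i) ->
  exists2 x, D x & \sum_i u i * expR (g i x - 2 * B i ^+ 2) < 1.
Proof.
move=> u0 u1 g0 gB.
(* The weighted linear parts of the exponential inequality; their value at [x] bounds what the
   potential gains over [\sum_i u i]. *)
have gz : mean_zero mu D
    (fun x => \sum_i u i * expR (- (2 * B i ^+ 2)) * g i x).
  by apply: mean_zero_sum => i; exact: mean_zero_scale.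
have /(mean_zero_lt gz)[x Dx xlt] : 0 < 1 - \sum_i u i by rewrite subr_gt0.
exists x => //; move: xlt; rewrite ltrBrDr; apply: le_lt_trans.
rewrite -big_split/=; apply: ler_sum => i _.
rewrite -mulrA -[X in _ <= _ + X]mulr1 -mulrDr; apply: ler_wpM2l => //.
rewrite -[X in _ <= _ + X](expRxMexpNx_1 (2 * B i ^+ 2)) [X in _ <= _ + X]mulrC.
rewrite -mulrDr expRD mulrC; apply: ler_wpM2l; first exact: expR_ge0.
rewrite (le_trans (expR_le_addr_expR_sqr _))// lerD2l ler_expR ler_pM2l//.
by rewrite -[g i x ^+ 2]real_normK ?num_real// lerXn2r ?nnegrE ?gB//
  (le_trans (normr_ge0 _) (gB _ _ Dx)).
Qed.

(** Induction on [m] for all weights at once: after a point is chosen, the updated terms of the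
    potential serve as the weights for the remaining points. *)
Lemma exists_good_points (I : finType) (B : I -> R) (g : I -> T -> R) (m : nat)
    (u : I -> R) :
  (forall i, 0 <= u i) -> \sum_i u i < 1 ->
  (forall i, mean_zero mu D (g i)) ->
  (forall i x, D x -> `|g i x| <= B i) ->
  exists2 xi : 'I_m -> T, forall j, D (xi j) &
    \sum_i u i * expR (\sum_j g i (xi j) - m%:R * (2 * B i ^+ 2)) < 1.
Proof.
move=> + + g0 gB; elim: m u => [|m IHm] u u0 u1.
  have /set0P[x0 Dx0] : D != set0.
    by apply/eqP => D0; move: muD; rewrite D0 measure0 => -[] /eqP; rewrite eq_sym oner_eq0.
  exists (fun=> x0) => //; rewrite (eq_bigr u)// => i _.
  by rewrite big_ord0 mul0r subr0 expR0 mulr1.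
have [x Dx xlt] := exists_good_point u0 u1 g0 gB.
have [|xi Dxi xilt] := IHm _ _ xlt.
  by move=> i; rewrite mulr_ge0// expR_ge0.
exists (fun j => if unlift ord0 j is Some k then xi k else x).
  by move=> j; case: unliftP.
apply: le_lt_trans xilt; apply: ler_sum => i _.
rewrite -mulrA -expRD big_ord_recl unlift_none.
under eq_bigr do rewrite liftK.
by apply: ler_wpM2l => //; rewrite ler_expR -natr1; lra.
Qed.

(* The 2 accounts for the two signs of each deviation; the parameter
   [sqrt (L i / m) / A i] of the exponential balances [L i] against the
   quadratic term. *)
Lemma exists_sampling_points (I : finType) (A L : I -> R) (h : I -> T -> R)
    (m : nat) :
  (0 < m)%N -> (forall i, 0 < A i) -> (forall i, 0 < L i) ->
  \sum_i 2 * expR (- L i) < 1 ->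
  (forall i, mean_zero mu D (h i)) ->
  (forall i x, D x -> `|h i x| <= A i) ->
  exists2 xi : 'I_m -> T, forall j, D (xi j) &
    forall i, `|m%:R^-1 * \sum_j h i (xi j)| <= 3 * A i * Num.sqrt (L i / m%:R).
Proof.
move=> m0 A0 L0 L1 h0 hA.
have mR : 0 < m%:R :> R by rewrite ltr0n.
pose s i := Num.sqrt (L i / m%:R).
have s0 i : 0 < s i by rewrite sqrtr_gt0 divr_gt0.
have ss i : m%:R * s i ^+ 2 = L i.
  by rewrite sqr_sqrtr ?divr_ge0 ?ltW// mulrC divfK// gt_eqF.
pose g (p : I * bool) x := (-1) ^+ p.2 * (s p.1 / A p.1) * h p.1 x.
have [||||xi Dxi xilt] := @exists_good_points (I * bool)%type (fun p => s p.1) g m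
    (fun p => expR (- L p.1)).
- by move=> p; exact: expR_ge0.
- rewrite -(pair_bigA _ (fun i (_ : bool) => expR (- L i)))/=.
  by under eq_bigr do rewrite big_bool/= -mulr2n -mulr_natl.
- by move=> p; exact: mean_zero_scale.
- move=> p x Dx; rewrite /g !(normrM, normrX) normrN1 expr1n mul1r.
  rewrite normfV (gtr0_norm (s0 _)) (gtr0_norm (A0 _)) -mulrA.
  rewrite ler_piMr ?(ltW (s0 _))// mulrC ler_pdivrMr// mul1r.
  exact: hA.
exists xi => // i.
have key (c : bool) : (-1) ^+ c * \sum_j h i (xi j) <= 3 * A i * s i * m%:R.
  (* All summands are nonnegative, so each is below 1 and has a negative exponent. With
     [L i = m s_i^2] the sum of [g] is then below [L i + 2 m s_i^2 = 3 m s_i^2], whence the factor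
     3. *)
  have : expR (- L i) * expR (\sum_j g (i, c) (xi j) - m%:R * (2 * s i ^+ 2)) < 1.
    apply: le_lt_trans xilt; rewrite (bigD1 (i, c))//= lerDl sumr_ge0//.
  rewrite -expRD -[ltRHS]expR0 ltr_expR => H.
  have {}H : \sum_j g (i, c) (xi j) <= 3 * (m%:R * s i ^+ 2).
    by have := ss i; lra.
  rewrite /g /= -mulr_sumr in H.
  have sA : 0 < s i / A i by rewrite divr_gt0.
  rewrite -(ler_pM2l sA) mulrA [X in X * _]mulrC (le_trans H)// le_eqVlt; apply/orP; left.
  apply/eqP; field; exact: lt0r_neq0.
rewrite normrM normfV (gtr0_norm mR) mulrC ler_pdivrMr// ler_norml.
have := key false; have := key true; rewrite expr0 expr1 mul1r mulN1r -/(s i) => k1 k2.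
by rewrite lerNl k1 k2.
Qed.

End MeanZero.

(** * Chaining over nets of cardinality 2^(2^k) *)

(** The budget for controlling all levels simultaneously. As [expR (- 4) <= 1/16], level k weighs at
    most [2 * 8^(-2^k) <= 2^(-(k+1))]; the explicit geometric gap [2^(-n)] makes the induction go
    through. *)
Lemma level_weights_lt1 (R : realType) (n : nat) :
  \sum_(k < n) (2 ^ 2 ^ k)%:R * (2 * expR (- (4 * 2 ^+ k))) < 1 :> R.
Proof.
suff : \sum_(k < n) (2 ^ 2 ^ k)%:R * (2 * expR (- (4 * 2 ^+ k)))
    <= 1 - 2^-1 ^+ n :> R.
  by move=> /le_lt_trans; apply; rewrite gtrBl exprn_gt0// invr_gt0.
have e4 : expR (- 4) <= 16^-1 :> R.
  rewrite expRN lef_pV2 ?posrE ?expR_gt0//.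
  have e1 : 2 <= expR 1 :> R by have := expR_ge1Dx (1 : R); lra.
  have -> : (4 : R) = 4%:R * 1 by rewrite mulr1.
  rewrite expRM_natl (le_trans _ (lerXn2r 4 _ _ e1)) ?nnegrE ?expR_ge0//.
  by rewrite -natrX ler_nat.
elim: n => [|n IHn]; first by rewrite big_ord0 expr0 subrr.
rewrite big_ord_recr/=.
suff H : (2 ^ 2 ^ n)%:R * (2 * expR (- (4 * 2 ^+ n))) <= 2^-1 ^+ n.+1 :> R.
  by rewrite exprS in H *; lra.
have -> : expR (- (4 * 2 ^+ n)) = expR (- 4) ^+ (2 ^ n) :> R.
  by rewrite -expRM_natl natrX; congr expR; ring.
rewrite mulrCA natrX -exprMn.
apply: (@le_trans _ _ (2 * 8^-1 ^+ (2 ^ n))).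
  rewrite ler_pM2l// lerXn2r ?nnegrE ?invr_ge0 ?mulr_ge0 ?expR_ge0//; lra.
apply: (@le_trans _ _ (2 * 8^-1 ^+ n.+1)).
  rewrite ler_pM2l// ler_wiXn2l ?invr_ge0//; first lra.
  exact: ltn_expl.
rewrite !exprS mulrA; apply: ler_pM; rewrite ?exprn_ge0 ?invr_ge0//; first lra.
  by rewrite lerXn2r ?nnegrE ?invr_ge0//; lra.
Qed.

Lemma le_sqrB (R : realFieldType) (M e y z : R) :
  `|y| <= M -> `|z| <= M -> `|y - z| <= e -> `|y ^+ 2 - z ^+ 2| <= 2 * M * e.
Proof.
move=> yM zM yz; rewrite subr_sqr normrM mulrC ler_pM//.
by rewrite (le_trans (ler_normD _ _))// mulr2n mulrDl mul1r lerD.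
Qed.

Section Sampling.
Context d (T : measurableType d) (R : realType) (mu : probability T R).
Context (D : set T) (mD : measurable D) (muD : mu D = 1%E).

(** Signed, hence linear in [u], so that the errors of squares telescope along a chain. *)
Definition sampling_error m (xi : 'I_m -> T) (u : T -> R) : R :=
  \int[mu]_(x in D) u x - m%:R^-1 * \sum_j u (xi j).

Lemma bounded_integrable (u : T -> R) (B : R) :
  measurable_fun D u -> (forall x, D x -> `|u x| <= B) ->
  mu.-integrable D (EFin \o u).
Proof.
move=> mu_ uB; apply: measurable_bounded_integrable => //.
  by have := ltry (1 : R); rewrite -muD.
exists B; split; rewrite ?num_real// => y By x Dx /=.
by rewrite (le_trans (uB _ Dx))// ltW.
Qed.

Lemma normr_Rintegral_le (u : T -> R) (B : R) :
  measurable_fun D u -> (forall x, D x -> `|u x| <= B) ->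
  `|\int[mu]_(x in D) u x| <= B.
Proof.
move=> mu_ uB; have iu := bounded_integrable mu_ uB.
rewrite (le_trans (le_normr_Rintegral mD iu))//.
have -> : B = \int[mu]_(x in D) B.
  rewrite Rintegral_cst// (_ : fine _ = 1) ?mulr1//.
  exact: (congr1 fine muD).
apply: le_Rintegral => //; first exact: integrable_norm iu.
by apply: (@bounded_integrable _ `|B|).
Qed.

Lemma mean_zero_center (u : T -> R) (B : R) :
  measurable_fun D u -> (forall x, D x -> `|u x| <= B) ->
  mean_zero mu D (fun x => \int[mu]_(x in D) u x - u x).
Proof.
move=> mu_ uB; have iu := bounded_integrable mu_ uB.
set c := \int[mu]_(x in D) u x.
have ic : mu.-integrable D (EFin \o cst c) by exact: (@bounded_integrable _ `|c|).
split; first by apply: eq_integrable (integrableB mD ic iu).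
rewrite RintegralB// Rintegral_cst// (_ : fine _ = 1) ?mulr1 ?subrr//.
exact: (congr1 fine muD).
Qed.

Lemma sampling_errorB m (xi : 'I_m -> T) (u v : T -> R) :
  mu.-integrable D (EFin \o u) -> mu.-integrable D (EFin \o v) ->
  sampling_error xi (fun x => u x - v x) =
  sampling_error xi u - sampling_error xi v.
Proof. by move=> iu iv; rewrite /sampling_error RintegralB// sumrB; ring. Qed.

(** Integral and average are each at most [B]. This cancellation-free bound serves the end of the
    chain, where the remainders form a possibly infinite family. *)
Lemma sampling_error_le m (xi : 'I_m -> T) (u : T -> R) (B : R) :
  (0 < m)%N -> (forall j, D (xi j)) ->
  measurable_fun D u -> (forall x, D x -> `|u x| <= B) ->
  `|sampling_error xi u| <= 2 * B.
Proof.
move=> m0 Dxi mu_ uB; rewrite (le_trans (ler_normB _ _))//.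
rewrite mulr2n mulrDl mul1r lerD ?normr_Rintegral_le//.
rewrite normrM normfV normr_nat mulrC ler_pdivrMr ?ltr0n//.
rewrite (le_trans (ler_norm_sum _ _ _))//.
have -> : B * m%:R = \sum_(j < m) B.
  by rewrite sumr_const card_ord mulr_natr.
by apply: ler_sum => j _; exact: uB.
Qed.

(** The square of [f] is split into the square of a coarsest net element, increments of squares
    between consecutive nets, and the remainder beyond level [K]; the three terms of the bound
    correspond to these. *)
Lemma exists_chaining_points (W : set (T -> R)) (M : R) (e : nat -> R)
    (K m : nat) :
  (0 < m)%N -> 0 < M -> (forall k, 0 < e k) ->
  (forall f, W f -> measurable_fun D f) ->
  (forall f x, W f -> D x -> `|f x| <= M) ->
  (forall k, exists c : 'I_(2 ^ 2 ^ k) -> T -> R, (forall j, W (c j)) /\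
     forall f, W f -> exists j, forall x, D x -> `|f x - c j x| <= e k) ->
  exists2 xi : 'I_m -> T, forall j, D (xi j) &
    forall f, W f -> `|sampling_error xi (fun x => f x ^+ 2)| <=
      6 * M ^+ 2 * Num.sqrt (4 / m%:R) +
      \sum_(k < K) 12 * M * e k * Num.sqrt (4 * 2 ^+ k.+1 / m%:R) +
      4 * M * e K.
Proof.
move=> m0 M0 e0 mW WM cover.
pose c k := projT1 (cid (cover k)).
have Wc k j : W (c k j) := (projT2 (cid (cover k))).1 j.
have cW k := (projT2 (cid (cover k))).2 :
  forall f, W f -> exists j, forall x, D x -> `|f x - c k j x| <= e k.
(* Nets consist of elements of [W], so the level-k net also covers the finer one. A neighbour fixed
   per finer element leaves 2^(2^(k+1)) increments instead of a product of two net sizes. *)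
have next k : {nxt : 'I_(2 ^ 2 ^ k.+1) -> 'I_(2 ^ 2 ^ k) &
    forall j x, D x -> `|c k.+1 j x - c k (nxt j) x| <= e k}.
  apply: (choice (P := fun j i =>
    forall x, D x -> `|c k.+1 j x - c k i x| <= e k)) => j.
  exact: cW (Wc _ _).
pose nxt k := projT1 (next k); have nxtP k := projT2 (next k).
pose U k : 'I_(2 ^ 2 ^ k) -> T -> R :=
  match k with
  | 0 => fun j x => c 0 j x ^+ 2
  | k.+1 => fun j x => c k.+1 j x ^+ 2 - c k (nxt k j) x ^+ 2
  end.
(* The index shifts: an increment into level k+1 is governed by the radius [e k] of the coarser
   net. *)
pose B k := if k is k.+1 then 2 * M * e k else M ^+ 2.
have B0 k : 0 < B k by case: k => [|k] /=; rewrite ?exprn_gt0// !mulr_gt0.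
have mU k j : measurable_fun D (U k j).
  case: k j => [|k] j /=; first by apply: measurable_funX; exact/mW/Wc.
  by apply: measurable_funB; apply: measurable_funX; exact/mW/Wc.
have UB k j x : D x -> `|U k j x| <= B k.
  case: k j => [|k] j Dx /=.
    by rewrite normrX lerXn2r ?nnegrE ?WM// ltW.
  by apply: le_sqrB; rewrite ?WM// nxtP.
(* All levels are indexed together so that one choice of points serves them all. Centring at most
   doubles the bounds, hence [2 * B] below. *)
pose I : finType := {k : 'I_K.+1 & 'I_(2 ^ 2 ^ k)}.
have [|||||xi Dxi xiP] := @exists_sampling_points _ _ _ mu D mD muD I
    (fun p => 2 * B (tag p)) (fun p => 4 * 2 ^+ tag p)
    (fun p x => \int[mu]_(x in D) U (tag p) (tagged p) x - U (tag p) (tagged p) x)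
    m m0.
- by move=> p; rewrite mulr_gt0.
- by move=> p; rewrite mulr_gt0// exprn_gt0.
- have := level_weights_lt1 R K.+1; congr (_ < _).
  rewrite -(@sig_big_dep R 0 _ 'I_K.+1 (fun k => 'I_(2 ^ 2 ^ k)) xpredT
    (fun=> xpredT) (fun k _ => 2 * expR (- (4 * 2 ^+ k))))/=.
  by apply: eq_bigr => k _; rewrite sumr_const card_ord mulr_natl.
- by move=> p; apply: mean_zero_center (UB _ _).
- move=> p x Dx; rewrite (le_trans (ler_normB _ _))//.
  by rewrite mulr2n mulrDl mul1r lerD ?UB// normr_Rintegral_le// => y; exact: UB.
have mR : 0 < m%:R :> R by rewrite ltr0n.
have errU k (kK : (k <= K)%N) (j : 'I_(2 ^ 2 ^ k)) :
    `|sampling_error xi (U k j)| <= 6 * B k * Num.sqrt (4 * 2 ^+ k / m%:R).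
  have := xiP (Tagged (fun k : 'I_K.+1 => 'I_(2 ^ 2 ^ k)) (j : 'I_(2 ^ 2 ^ Ordinal (kK : (k < K.+1)%N)))).
  rewrite /= sumrB sumr_const card_ord -(mulr_natl (Rintegral _ _ _)) mulrBr.
  rewrite mulKf ?gt_eqF//.
  by rewrite mulrA -natrM.
exists xi => // f Wf.
have isqr g : W g -> mu.-integrable D (EFin \o (fun x => g x ^+ 2)).
  move=> Wg; apply: (@bounded_integrable _ (M ^+ 2)).
    by apply: measurable_funX; exact: mW.
  by move=> x Dx; rewrite normrX lerXn2r ?nnegrE ?WM// ltW.
(* The increments in [U] follow, for each net element, its chain of nearest
   elements [nxt] down to the coarsest net. *)
have errc k (j : 'I_(2 ^ 2 ^ k)) : (k <= K)%N ->
    `|sampling_error xi (fun x => c k j x ^+ 2)| <=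
    6 * M ^+ 2 * Num.sqrt (4 / m%:R) +
      \sum_(i < k) 12 * M * e i * Num.sqrt (4 * 2 ^+ i.+1 / m%:R).
  elim: k j => [|k IHk] j kK.
    by rewrite big_ord0 addr0; have := errU 0 kK j; rewrite expr0 mulr1.
  rewrite big_ord_recr/= addrA.
  have -> : sampling_error xi (fun x => c k.+1 j x ^+ 2) =
      sampling_error xi (fun x => c k (nxt k j) x ^+ 2) +
      sampling_error xi (U k.+1 j).
    by rewrite /= sampling_errorB; [ring|exact/isqr/Wc..].
  rewrite (le_trans (ler_normD _ _))// lerD ?IHk ?(ltnW kK)//.
  rewrite (le_trans (errU _ kK j))//= le_eqVlt; apply/orP; left; apply/eqP; ring.
have [j fj] := cW K f Wf.
have -> : sampling_error xi (fun x => f x ^+ 2) =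
    sampling_error xi (fun x => c K j x ^+ 2) +
    sampling_error xi (fun x => f x ^+ 2 - c K j x ^+ 2).
  by rewrite sampling_errorB ?isqr//; ring.
rewrite (le_trans (ler_normD _ _))// lerD ?errc//.
have -> : 4 * M * e K = 2 * (2 * M * e K) by ring.
apply: sampling_error_le => //.
  by apply: measurable_funB; apply: measurable_funX; apply: mW.
by move=> x Dx; apply: le_sqrB; rewrite ?WM// fj.
Qed.

End Sampling.

(** * Summation of the level contributions *)

Lemma powRX_natl (R : realType) (n : nat) (s : R) (k : nat) :
  (n ^ k)%:R `^ s = (n%:R `^ s) ^+ k.
Proof. by rewrite natrX -powR_mulrn ?ler0n// powRAC powR_mulrn ?powR_ge0. Qed.

Lemma sqrt_level_le (R : realType) (m k : nat) : (0 < m)%N ->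
  Num.sqrt (4 * 2 ^+ k.+1 / m%:R) <=
    3 * ((2 ^ k)%:R `^ 2^-1 * m%:R `^ (- 2^-1)) :> R.
Proof.
move=> m0.
have -> : 4 * 2 ^+ k.+1 / m%:R = 8 * ((2 ^ k)%:R * m%:R^-1) :> R.
  by rewrite natrX exprS; ring.
rewrite sqrtrM// sqrtrM ?ler0n//; apply: ler_pM; rewrite ?mulr_ge0 ?sqrtr_ge0//.
  rewrite -[leRHS]ger0_norm// -sqrtr_sqr ler_sqrt ?exprn_ge0//.
  by rewrite -natrX ler_nat.
by rewrite powR12_sqrt ?ler0n// powRN powR12_sqrt ?ler0n// sqrtrV ?ler0n.
Qed.

(** [lam] stands for the logarithmic factor frozen at its value for [m], so only powers of 2^k
    remain to be summed. *)
Lemma chaining_rate (R : realType) (r M lam : R) (m : nat) (e : nat -> R) :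
  0 < r -> r < 2^-1 -> 0 < M -> (0 < m)%N -> 0 <= lam ->
  (forall k, (2 ^ k <= m)%N -> e k <= 2 * ((2 ^ k)%:R `^ (- r) * lam)) ->
  \sum_(k < trunc_log 2 m) 12 * M * e k * Num.sqrt (4 * 2 ^+ k.+1 / m%:R) +
    4 * M * e (trunc_log 2 m) <=
  (72 * M / (2 `^ (2^-1 - r) - 1) + 8 * M * 2 `^ r) * (m%:R `^ (- r) * lam).
Proof.
move=> r0 r2 M0 m0 lam0 ele.
have mR : 0 < m%:R :> R by rewrite ltr0n.
set q := 2 `^ (2^-1 - r); set K := trunc_log 2 m.
have /andP[Km mK] := trunc_log_bounds (isT : (1 < 2)%N) m0.
have q1 : 0 < q - 1.
  rewrite subr_gt0 /q /powR pnatr_eq0/= -[ltLHS]expR0 ltr_expR.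
  by rewrite mulr_gt0 ?subr_gt0// ln_gt0// ltr1n.
rewrite [leRHS]mulrDl; apply: lerD.
  (* The constant is 72 = 12 * 2 * 3: 2 comes from the bound on [e k] and 3 from [sqrt_level_le]. *)
  apply: (@le_trans _ _
      (\sum_(k < K) 72 * M * lam * m%:R `^ (- 2^-1) * q ^+ k)).
    apply: ler_sum => k _.
    have km : (2 ^ k <= m)%N by rewrite (leq_trans _ Km)// leq_pexp2l// ltnW.
    have p2 : (2 ^ k)%:R `^ (- r) * (2 ^ k)%:R `^ 2^-1 = q ^+ k :> R.
      rewrite -powRD; last by rewrite pnatr_eq0 -lt0n expn_gt0 implybT.
      by rewrite addrC powRX_natl.
    rewrite -p2 -(mulrA (12 * M)).
    have -> : 72 * M * lam * m%:R `^ (- 2^-1) *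
        ((2 ^ k)%:R `^ (- r) * (2 ^ k)%:R `^ 2^-1) =
      12 * M * ((2 * ((2 ^ k)%:R `^ (- r) * lam)) *
        (3 * ((2 ^ k)%:R `^ 2^-1 * m%:R `^ (- 2^-1)))) by ring.
    apply: ler_wpM2l; first by rewrite mulr_ge0// ltW.
    apply: (@le_trans _ _ (2 * ((2 ^ k)%:R `^ (- r) * lam) *
        Num.sqrt (4 * 2 ^+ k.+1 / m%:R))).
      by apply: ler_wpM2r; [exact: sqrtr_ge0|exact: ele].
    apply: ler_wpM2l; first by rewrite !mulr_ge0 ?powR_ge0.
    exact: sqrt_level_le.
  rewrite -mulr_sumr.
  (* The sum times [q - 1] is at most [q ^+ K], that is [2^K] to the power [1/2 - r], and
     [2^K <= m]. *)
  have geo : \sum_(k < K) q ^+ k <= m%:R `^ (2^-1 - r) / (q - 1).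
    rewrite ler_pdivlMr// mulrC -subrX1 (le_trans (y := q ^+ K)) ?gerBl//.
    rewrite -powRX_natl; apply: ge0_ler_powR; rewrite ?nnegrE ?ler0n ?ler_nat//.
    by rewrite subr_ge0 ltW.
  rewrite (le_trans (ler_wpM2l _ geo))//.
    by rewrite !mulr_ge0 ?powR_ge0// ltW.
  have -> : m%:R `^ (- r) = m%:R `^ (- 2^-1) * m%:R `^ (2^-1 - r) :> R.
    rewrite -powRD; last by rewrite (gt_eqF mR) implybT.
    by congr powR; ring.
  by rewrite le_eqVlt; apply/orP; left; apply/eqP; ring.
(* Last level: [m < 2^(K+1)] lets [(2^K)^(-r)] be replaced by [m^(-r)] at the cost of [2^r]. *)
have -> : 8 * M * 2 `^ r * (m%:R `^ (- r) * lam) =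
    4 * M * (2 * ((2 `^ r * m%:R `^ (- r)) * lam)) by ring.
apply: ler_wpM2l; first by rewrite mulr_ge0// ltW.
rewrite (le_trans (ele _ Km))// ler_pM2l// ler_wpM2r//.
rewrite !powRN ler_pdivlMr ?powR_gt0// mulrC ler_pdivrMr ?powR_gt0 ?ltr0n ?expn_gt0//.
rewrite -powRM ?ler0n// -natrM -expnS.
by apply: ge0_ler_powR; rewrite ?nnegrE ?ler0n ?ler_nat ?(ltW r0) ?(ltnW mK)//.
Qed.

(** * Borel measurability on Omega and nets from entropy numbers *)

Section BorelRowVector.
Context (R : realType) (d : nat).

Lemma closed_borel_rV (A : set 'rV[R]_d) :
  closed A -> measurable (A : set (borel_rV R d)).
Proof.
move=> cA; rewrite -[A]setCK; apply: measurableC.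
by apply: sub_sigma_algebra; exact: closed_openC.
Qed.

(** Preimages of open intervals are traces on [A] of open sets, and [A] is Borel because it is
    closed. *)
Lemma continuous_within_measurable (A : set 'rV[R]_d) (f : 'rV[R]_d -> R) :
  closed A -> {within A, continuous f} ->
  measurable_fun (A : set (borel_rV R d)) (f : borel_rV R d -> R).
Proof.
move=> cA /continuousP cf.
apply: (measurability _ (RGenOpens.measurableE R)) => _ [_ [x [y ->] <-]].
have /open_subspaceP[V oV VA] := cf _ (@interval_open _ (BRight x) (BLeft y) isT isT).
rewrite setIC -VA; apply: measurableI; last exact: closed_borel_rV.
exact: sub_sigma_algebra.
Qed.

Lemma sup_norm_le (A : set 'rV[R]_d) (f : 'rV[R]_d -> R) (e : R) :
  (sup_norm A f <= e%:E)%E -> forall x, A x -> `|f x| <= e.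
Proof.
move=> fe x Ax; rewrite -lee_fin (le_trans _ fe)//.
by apply: ereal_sup_ubound; exists x.
Qed.

(** The inequality is strict because the infimum need not be attained. *)
Lemma entropy_number_cover (A : set 'rV[R]_d) (W : set ('rV[R]_d -> R))
    (n : nat) (e : R) :
  (entropy_number A W n < e%:E)%E ->
  exists c : 'I_(2 ^ n) -> 'rV[R]_d -> R, (forall j, W (c j)) /\
    forall f, W f -> exists j, forall x, A x -> `|f x - c j x| <= e.
Proof.
move=> /ereal_inf_lt[_ [eps [_ [c [Wc cW]]] <-]]; rewrite lte_fin => epse.
exists c; split => // f /cW[j _ /= fj]; exists j => x Ax.
by rewrite (le_trans _ (ltW epse))//; exact: (sup_norm_le fj).
Qed.

End BorelRowVector.

(** * From the entropy rate to the discretization rate *)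

Theorem theorem1p1 (R : realType) (a M r b : R)
    (a_gt1 : 1 < a) (M_gt0 : 0 < M) (r_gt0 : 0 < r) (r_lt : r < 2^-1)
    (b_ge0 : 0 <= b) :
  exists C : R,
  forall (d : nat) (Omega : set 'rV[R]_d) (mu : probability (borel_rV R d) R)
    (W : set ('rV[R]_d -> R)),
    compact Omega ->
    mu Omega = 1%E ->
    W `<=` continuous_functions Omega ->
    uniformly_compact Omega W ->
    (forall f, W f -> (sup_norm Omega f <= M%:E)%E) ->
    (forall n : nat, (0 < n)%N ->
       (entropy_number Omega W n
          <= (n%:R `^ (- r) * (log_base a n.+1%:R) `^ b)%:E)%E) ->
    forall m : nat, (0 < m)%N ->
      (er_L2 mu Omega W m
         <= (C * m%:R `^ (- r) * (log_base a m.+1%:R) `^ b)%:E)%E.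
Proof.
pose lam n : R := (log_base a n.+1%:R) `^ b.
pose C0 := 72 * M / (2 `^ (2^-1 - r) - 1) + 8 * M * 2 `^ r.
(* [C0] pays for the increments and the remainder. The first summand pays for the coarsest net, of
   order [m^(-1/2) <= m^(-r)], using [lam m >= lam 1 > 0]. *)
exists (12 * M ^+ 2 / lam 1 + C0).
move=> d Omega mu W cO muO Wcont _ WM ent m m0.
have lna : 0 < ln a by rewrite ln_gt0.
have lamM : {homo lam : n p / (n <= p)%N >-> n <= p}.
  move=> n p np; apply: ge0_ler_powR => //; rewrite ?nnegrE /log_base ?divr_ge0 ?(ltW lna) ?ln_ge0 ?ler1n//.
  by rewrite ler_pM2r ?invr_gt0// ler_ln ?posrE ?ltr0n// ler_nat.
have lam0 n : (0 < n)%N -> 0 < lam n.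
  by move=> n0; rewrite powR_gt0// divr_gt0// ln_gt0// ltr1n.
have clO : closed Omega := compact_closed (@norm_hausdorff _ _) cO.
have mO := closed_borel_rV clO.
(* Doubling the positive entropy bound at [n = 2^k] gives the strict inequality from which a net is
   extracted. *)
pose e k : R := 2 * ((2 ^ k)%:R `^ (- r) * lam (2 ^ k)%N).
have e0 k : 0 < e k by rewrite !mulr_gt0 ?lam0 ?expn_gt0// powR_gt0// ltr0n expn_gt0.
have [|f x Wf|k|xi Oxi xiW] := @exists_chaining_points _ _ _ mu Omega mO muO
    W M e (trunc_log 2 m) m m0 M_gt0 e0.
- by move=> f /Wcont; exact: continuous_within_measurable.
- exact: (sup_norm_le (WM _ Wf)).
- apply: entropy_number_cover; rewrite (le_lt_trans (ent _ _)) ?expn_gt0//.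
  rewrite lte_fin; have := e0 k; rewrite /e -/(lam _); lra.
apply: ereal_inf_le; exists (ereal_sup [set (discretization_error mu Omega xi f)%:E | f in W]).
  by exists xi.
apply: ub_ereal_sup => _ [f Wf <-]; rewrite lee_fin.
have -> : discretization_error mu Omega xi f =
    `|sampling_error mu Omega xi (fun x => f x ^+ 2)|.
  rewrite /discretization_error /sampling_error; congr (`|_ - _ * _|).
    by apply: eq_Rintegral => x _; rewrite real_normK ?num_real.
  by apply: eq_bigr => j _; rewrite real_normK ?num_real.
rewrite (le_trans (xiW f Wf))// -addrA -[leRHS]mulrA [leRHS]mulrDl lerD//; last first.
  apply: chaining_rate => //; first exact/ltW/lam0.
  by move=> k km; rewrite /e !ler_pM2l ?powR_gt0 ?ltr0n ?expn_gt0//; exact: lamM.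
have mR : 0 < m%:R :> R by rewrite ltr0n.
have -> : Num.sqrt (4 / m%:R) = 2 * m%:R `^ (- 2^-1) :> R.
  rewrite sqrtrM// sqrtrV ?ler0n// powRN powR12_sqrt ?ler0n//.
  by rewrite (_ : 4 = 2 ^+ 2) ?sqrtr_sqr ?ger0_norm//; ring.
have -> : 12 * M ^+ 2 / lam 1 * (m%:R `^ (- r) * lam m) =
    12 * M ^+ 2 * (m%:R `^ (- r) * (lam m / lam 1)) by ring.
have -> : 6 * M ^+ 2 * (2 * m%:R `^ (- 2^-1)) =
    12 * M ^+ 2 * (m%:R `^ (- 2^-1) * 1) by ring.
apply: ler_wpM2l; first by rewrite mulr_ge0// exprn_ge0// ltW.
apply: ler_pM; rewrite ?powR_ge0//.
  by apply: ler_powR; rewrite ?ler1n// lerN2 ltW.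
by rewrite ler_pdivlMr ?lam0// mul1r; exact: lamM.
Qed.
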